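(* Let $G_1,G_2$ be finite connected simple graphs, $x_1\in V(G_1)$, $x_2\in V(G_2)$, and let $G_1[x_1]\oplus G_2[x_2]$ be their $1$-sum. For every $\lambda\in[0,2]$, \[m_{G_1[x_1]\oplus G_2[x_2]}(\lambda)\geq m_{G_1}(\lambda)+m_{G_2}(\lambda)-1.\]
   Context: The $1$-sum $G_1[x_1]\oplus G_2[x_2]$ is obtained from the disjoint union of $G_1$ and $G_2$ by identifying $x_1$ and $x_2$ into a single new vertex. For a graph $H$, $m_H(\lambda)$ denotes the multiplicity of $\lambda$ as an eigenvalue of the normalized Laplacian $L=\mathrm{Id}-D^{-1}A$ of $H$ (zero if $\lambda$ is not an eigenvalue). *)

(* Defs.v *)
(* MathComp; the real numbers are an arbitrary realType. *)
From HB Require Import structures.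
From mathcomp Require Import all_boot all_order all_algebra.
From mathcomp Require Import reals.

Set Implicit Arguments.
Unset Strict Implicit.
Unset Printing Implicit Defensive.

Import Order.TTheory GRing.Theory Num.Theory.

Local Open Scope quotient_scope.
Local Open Scope ring_scope.

Record sgraph := SGraph {
  vertex :> finType;
  adj : rel vertex;
  adj_sym : symmetric adj;
  adj_irrefl : irreflexive adj }.

Definition connected_graph (G : sgraph) : Prop :=
  forall u v : G, connect (@adj G) u v.

Section OneSum.

Variables (G1 G2 : sgraph) (x1 : G1) (x2 : G2).

Definition disj_adj : rel (G1 + G2)%type := fun u v =>
  match u, v with
  | inl a, inl b => adj a b
  | inr a, inr b => adj a b
  | _, _ => false
  end.

Definition glued : pred (G1 + G2)%type := pred2 (inl x1) (inr x2).

Definition glue : rel (G1 + G2)%type := fun u v =>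
  (u == v) || (glued u && glued v).

Lemma glue_refl : reflexive glue.
Proof. by move=> u; rewrite /glue eqxx. Qed.

Lemma glue_sym : symmetric glue.
Proof. by move=> u v; rewrite /glue eq_sym andbC. Qed.

Lemma glue_trans : transitive glue.
Proof.
move=> v u w /orP[/eqP-> //|/andP[gu gv]] /orP[/eqP<-|/andP[_ gw]];
  by rewrite /glue ?gu ?gv ?gw orbT.
Qed.

Canonical glue_equiv := EquivRel glue glue_refl glue_sym glue_trans.

Definition one_sum_vertex := {eq_quot glue}.
HB.instance Definition _ := EqQuotient.on one_sum_vertex.
HB.instance Definition _ := Choice.on one_sum_vertex.
HB.instance Definition _ : isCountable one_sum_vertex :=
  CanIsCountable (@reprK _ one_sum_vertex).
HB.instance Definition _ : isFinite one_sum_vertex :=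
  CanIsFinite (@reprK _ one_sum_vertex).

Definition one_sum_adj : rel one_sum_vertex := fun p q =>
  [exists u, exists v,
    [&& \pi_one_sum_vertex u == p, \pi_one_sum_vertex v == q & disj_adj u v]].

Lemma disj_adj_sym : symmetric disj_adj.
Proof. by move=> [a|a] [b|b] //=; apply: adj_sym. Qed.

Lemma disj_adj_not_glue u v : disj_adj u v -> ~~ glue u v.
Proof.
move=> uv; apply/negP; case/orP=> [/eqP euv|/andP[]].
  by move: uv; rewrite euv; case: (v) => a; rewrite /= adj_irrefl.
by case/orP=> /eqP eu /orP[] /eqP ev; move: uv; rewrite eu ev //= adj_irrefl.
Qed.

Lemma one_sum_adj_sym : symmetric one_sum_adj.
Proof.
suff sub p q : one_sum_adj p q -> one_sum_adj q p.
  by move=> p q; apply/idP/idP; apply: sub.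
case/existsP=> u /existsP[v /and3P[up vq uv]].
by apply/existsP; exists v; apply/existsP; exists u; rewrite up vq disj_adj_sym.
Qed.

Lemma one_sum_adj_irrefl : irreflexive one_sum_adj.
Proof.
move=> p.
apply/negbTE/negP => /existsP[u /existsP[v /and3P[/eqP<- vu uv]]].
have := disj_adj_not_glue uv; rewrite glue_sym => /negP; apply.
by rewrite -[glue v u](eqmodE glue_equiv).
Qed.

Definition one_sum : sgraph :=
  SGraph one_sum_adj_sym one_sum_adj_irrefl.

End OneSum.

Section NormalizedLaplacian.

Variables (R : realType) (G : sgraph).

Definition degree (v : G) : nat := #|[set w | adj v w]|.

Definition adjacency_mx : 'M[R]_#|G| :=
  \matrix_(i, j) (adj (enum_val i) (enum_val j))%:R.

(* D^-1; since 0^-1 = 0, an isolated vertex has entry 0, so that the normalized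
   Laplacian acts as the identity there. *)
Definition inv_degree_mx : 'M[R]_#|G| :=
  diag_mx (\row_i (degree (enum_val i))%:R^-1).

Definition normalized_laplacian : 'M[R]_#|G| :=
  1%:M - inv_degree_mx *m adjacency_mx.

(* The dimension of {f | L f = lambda f}; the transpose is there because
   eigenspace consists of row vectors acted upon from the right.  As L is
   diagonalizable (being similar to a symmetric matrix), this is also the
   algebraic multiplicity of lambda. *)
Definition multiplicity (lambda : R) : nat :=
  \rank (eigenspace normalized_laplacian^T lambda).

End NormalizedLaplacian.

(* Main.v *)
Require Import Defs.
From mathcomp Require Import all_boot all_order all_algebra.
From mathcomp Require Import reals.

(** If [f1], [f2] are eigenfunctions for the same eigenvalue and
    [f1 x1 = f2 x2], they glue to an eigenfunction of the 1-sum: after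
    multiplication by the degree, the eigenvalue equation is additive over the
    vertices being identified.  The condition [f1 x1 = f2 x2] cuts out a
    subspace of codimension at most one in the direct sum of the two eigenspaces, and
    gluing is injective because it is inverted by restriction. *)

Set Implicit Arguments.
Unset Strict Implicit.
Unset Printing Implicit Defensive.

Import Order.TTheory GRing.Theory Num.Theory.

Local Open Scope quotient_scope.
Local Open Scope ring_scope.

Definition eigenfunction (R : realType) (G : sgraph) (lambda : R)
    (f : G -> R) :=
  forall v : G,
    f v - (degree v)%:R^-1 * (\sum_(w | adj v w) f w) = lambda * f v.

Lemma degree0_sum (R : realType) (G : sgraph) (v : G) (f : G -> R) :
  degree v = 0%N -> \sum_(w | adj v w) f w = 0.
Proof.
move=> /eqP; rewrite cards_eq0 => /eqP nbr0; apply: big_pred0 => w.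
by have := in_set0 w; rewrite -nbr0 inE.
Qed.

(** The eigenvalue equation with its denominator cleared, the form in which it adds up over
    identified vertices. At an isolated vertex both sides are zero, the sum being empty. *)
Lemma eigenfunction_degree (R : realType) (G : sgraph) (lambda : R)
    (f : G -> R) (v : G) :
  eigenfunction lambda f ->
  \sum_(w | adj v w) f w = (degree v)%:R * ((1 - lambda) * f v).
Proof.
move=> /(_ v) fv; have [d0|dn0] := eqVneq (degree v) 0%N.
  by rewrite degree0_sum // d0 mul0r.
rewrite mulrBl mul1r -fv opprB addrC subrK mulVKf //.
by rewrite pnatr_eq0.
Qed.

Lemma eigenspace_laplacianP (R : realType) (G : sgraph) (lambda : R)
    (u : 'rV[R]_#|G|) :
  reflect (eigenfunction lambda (fun v : G => u 0 (enum_rank v)))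
    (u <= eigenspace (normalized_laplacian R G)^T lambda)%MS.
Proof.
have entry (v : G) : (u *m (normalized_laplacian R G)^T) 0 (enum_rank v) =
    u 0 (enum_rank v)
    - (degree v)%:R^-1 * (\sum_(w | adj v w) u 0 (enum_rank w)).
  rewrite /normalized_laplacian linearB /= trmx1 mulmxBr mulmx1 !mxE.
  congr (_ - _); rewrite mulr_sumr [RHS]big_mkcond /=.
  rewrite (reindex (@enum_rank G)) /=; last first.
    by apply: onW_bij; apply: enum_rank_bij.
  apply: eq_bigr => w _; rewrite /inv_degree_mx mul_diag_mx !mxE !enum_rankK.
  by case: adj; rewrite ?mulr1 ?mulr0 // mulrC.
apply: (iffP eigenspaceP) => [uL v|uL]; first by rewrite -entry uL mxE.
by apply/rowP => i; rewrite -(enum_valK i) entry uL mxE.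
Qed.

Lemma mxrank_cap_ker_col (F : fieldType) (m n : nat) (A : 'M[F]_(m, n))
    (c : 'cV[F]_n) :
  (\rank A <= \rank (A :&: kermx c)%MS + 1)%N.
Proof.
(* By the dimension formula it suffices that the sum of the two spaces has rank at most [n], while
   the kernel of a single column has rank at least [n - 1]. *)
rewrite -(leq_add2r (\rank (kermx c))) -mxrank_sum_cap addnC -addnA leq_add2l.
rewrite mxrank_ker (leq_trans (rank_leq_col _)) //.
by rewrite -leq_subLR leq_sub2l ?rank_leq_col.
Qed.

Section Glue.

Variables (G1 G2 : sgraph) (x1 : G1) (x2 : G2).

Lemma disj_adj_irrefl : irreflexive (@disj_adj G1 G2).
Proof. by move=> [a|a] /=; apply: adj_irrefl. Qed.

Definition disj_union : sgraph :=
  SGraph (@disj_adj_sym G1 G2) disj_adj_irrefl.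

Local Notation pi := (\pi_(one_sum_vertex x1 x2)).

Lemma pi_eqE u v : (pi u == pi v) = glue x1 x2 u v.
Proof. exact: (eqmodE (glue_equiv x1 x2)). Qed.

Lemma disj_union_sum (R : realType) (f : disj_union -> R) (u : disj_union) :
  \sum_(w | adj u w) f w =
  match u with
  | inl a => \sum_(b | adj a b) f (inl b)
  | inr a => \sum_(b | adj a b) f (inr b)
  end.
Proof.
by case: u => a; rewrite big_sumType /= big_pred0_eq ?addr0 ?add0r.
Qed.

Lemma degree_disj_union (u : disj_union) :
  degree u = match u with inl a => degree a | inr a => degree a end.
Proof.
case: u => a; rewrite /degree !cardsE -!sum1_card big_sumType /= big_pred0_eq.
  exact: addn0.
exact: add0n.
Qed.

Lemma eigenfunction_disj_union (R : realType) (lambda : R)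
    (f : disj_union -> R) :
  eigenfunction lambda (fun a : G1 => f (inl a)) ->
  eigenfunction lambda (fun b : G2 => f (inr b)) ->
  eigenfunction lambda f.
Proof.
by move=> f1 f2 u; rewrite disj_union_sum degree_disj_union; case: u.
Qed.

(** The two glued vertices lie on different sides of the disjoint union, and edges stay on one
    side. *)
Lemma glued_neighbour_unique u v v' :
  @disj_adj G1 G2 u v -> @disj_adj G1 G2 u v' ->
  glued x1 x2 v -> glued x1 x2 v' -> v = v'.
Proof.
rewrite /glued => uv uv' /orP[]/eqP ev /orP[]/eqP ev'; subst v v' => //.
  by case: u uv uv'.
by case: u uv uv'.
Qed.

(** Gluing merges no two edges: if two lifts differed at one end only, their common end would be
    adjacent to both glued vertices; if at both ends, an edge would join glued vertices. *)
Lemma edge_lift_unique u v u' v' :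
  @disj_adj G1 G2 u v -> @disj_adj G1 G2 u' v' ->
  pi u = pi u' -> pi v = pi v' -> (u, v) = (u', v').
Proof.
move=> uv uv' /eqP; rewrite pi_eqE => uu /eqP; rewrite pi_eqE => vv.
case/orP: uu => [/eqP uu|/andP[gu gu']].
  case/orP: vv => [/eqP <-|/andP[gv gv']]; first by rewrite uu.
  by subst u'; rewrite (glued_neighbour_unique uv uv').
case/orP: vv => [/eqP vv|/andP[gv gv']].
  subst v'; rewrite disj_adj_sym in uv; rewrite disj_adj_sym in uv'.
  by rewrite (glued_neighbour_unique uv uv').
by move: (disj_adj_not_glue x1 x2 uv); rewrite /glue gu gv orbT.
Qed.

(** Each edge at [p] has exactly one lift. The codomain is any [nmodType] so that degrees, which are
    sums of ones in [nat], are covered too. *)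
Lemma one_sum_sum (R : nmodType) (f : one_sum x1 x2 -> R) (p : one_sum x1 x2) :
  \sum_(q | adj p q) f q =
  \sum_(u | pi u == p) \sum_(v | @disj_adj G1 G2 u v) f (pi v).
Proof.
rewrite pair_big_dep /=.
rewrite (partition_big (fun e => pi e.2) (@adj (one_sum x1 x2) p)) /=; last first.
  move=> [u v] /= /andP[up uv]; apply/existsP; exists u; apply/existsP; exists v.
  by rewrite up eqxx.
apply: eq_bigr => q /existsP[u /existsP[v /and3P[/eqP up /eqP vq uv]]].
rewrite (big_pred1 (u, v)) /= ?vq // => -[u' v'] /=.
apply/idP/eqP => [/andP[/andP[/eqP up' uv'] /eqP vq']|[-> ->]].
  by apply: edge_lift_unique => //; rewrite ?up ?up' ?vq ?vq'.
by rewrite up vq !eqxx uv.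
Qed.

Lemma degree_one_sum (p : one_sum x1 x2) :
  degree p = (\sum_(u : disj_union | pi u == p) degree u)%N.
Proof.
rewrite /degree cardsE -sum1_card.
rewrite [LHS](one_sum_sum (fun=> 1%N)); apply: eq_bigr => u _.
by rewrite cardsE -sum1_card.
Qed.

Lemma eigenfunction_one_sum (R : realType) (lambda : R)
    (f : one_sum x1 x2 -> R) :
  eigenfunction lambda (fun u : disj_union => f (pi u)) ->
  eigenfunction lambda f.
Proof.
move=> fpi p.
have sumE : \sum_(q | adj p q) f q = (degree p)%:R * ((1 - lambda) * f p).
  rewrite one_sum_sum degree_one_sum natr_sum mulr_suml.
  apply: eq_bigr => u /eqP <-.
  exact: (@eigenfunction_degree R disj_union lambda (fun u => f (pi u))).
have [d0|dn0] := eqVneq (degree p) 0%N; last first.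
  by rewrite sumE mulKf ?pnatr_eq0 // mulrBl mul1r subKr.
(* For isolated [p], [sumE] reads [0 = 0] and says nothing about [f p]; the equation is taken
   instead from a representative, which is isolated as well. *)
have dr0 : degree (repr p : disj_union) = 0%N.
  move/eqP: d0; rewrite degree_one_sum sum_nat_eq0 => /forallP/(_ (repr p)).
  by rewrite reprK eqxx => /eqP.
by have := fpi (repr p); rewrite reprK !degree0_sum // !mulr0.
Qed.

Lemma glue_function (T : Type) (h : disj_union -> T) :
  h (inl x1) = h (inr x2) ->
  exists f : one_sum x1 x2 -> T, forall u, f (pi u) = h u.
Proof.
move=> hx; exists (fun p => h (repr p)) => u.
have: pi (repr (pi u)) == pi u by rewrite reprK.
rewrite pi_eqE => /orP[/eqP -> //|/andP[]].
by rewrite /glued => /orP[]/eqP -> /orP[]/eqP ->.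
Qed.

End Glue.

Theorem theorem5p11 (R : realType) (G1 G2 : sgraph) (x1 : G1) (x2 : G2)
    (hG1 : connected_graph G1) (hG2 : connected_graph G2)
    (lambda : R) (hlambda : 0 <= lambda <= 2) :
  (multiplicity G1 lambda)%:Z + (multiplicity G2 lambda)%:Z - 1
    <= (multiplicity (one_sum x1 x2) lambda)%:Z.
Proof.
rewrite lerBlDr -!PoszD lez_nat /multiplicity.
set E1 := eigenspace _ _; set E2 := eigenspace _ _; set W := eigenspace _ _.
pose V := block_mx E1 0 0 E2.
(* Pairing with [c] sends [(u1, u2)] to [u1 x1 - u2 x2], so [kermx c] is the space of compatible
   pairs. *)
pose c : 'cV[R]_(#|G1| + #|G2|) :=
  col_mx (delta_mx (enum_rank x1) 0) (- delta_mx (enum_rank x2) 0).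
pose in1 (i : 'I_#|G1|) : 'I_#|one_sum x1 x2| :=
  enum_rank (\pi_(one_sum_vertex x1 x2) (inl (enum_val i)) : one_sum x1 x2).
pose in2 (i : 'I_#|G2|) : 'I_#|one_sum x1 x2| :=
  enum_rank (\pi_(one_sum_vertex x1 x2) (inr (enum_val i)) : one_sum x1 x2).
(* Right multiplication by [Q] restricts a function on the 1-sum to the two factors. *)
pose Q := row_mx (colsub in1 1%:M) (colsub in2 1%:M) :
  'M[R]_(#|one_sum x1 x2|, #|G1| + #|G2|).
(* Every compatible pair of eigenfunctions is the restriction of its glued eigenfunction; as
   [W *m Q] has rank at most that of [W], this bounds the compatible pairs. *)
have restrict : (V :&: kermx c <= W *m Q)%MS.
  apply/row_subP => i; move: (row_sub i (V :&: kermx c)%MS).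
  move: (row i _) => u; rewrite sub_capmx => /andP[/submxP[a uV] /sub_kermxP uc].
  rewrite -[u]hsubmxK in uc *.
  have u1 : (lsubmx u <= E1)%MS.
    by rewrite uV -[a]hsubmxK mul_row_block row_mxKl mulmx0 addr0 submxMl.
  have u2 : (rsubmx u <= E2)%MS.
    by rewrite uV -[a]hsubmxK mul_row_block row_mxKr mulmx0 add0r submxMl.
  move: (lsubmx u) (rsubmx u) u1 u2 uc => u1 u2 /eigenspace_laplacianP e1.
  move=> /eigenspace_laplacianP e2 uc.
  pose h (w : disj_union G1 G2) : R :=
    match w with inl a => u1 0 (enum_rank a) | inr b => u2 0 (enum_rank b) end.
  have [|f fh] := @glue_function _ _ x1 x2 _ h.
    move/matrixP/(_ 0 0): uc; rewrite mul_row_col mulmxN -!colE !mxE /=.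
    by move/eqP; rewrite subr_eq0 => /eqP.
  have ef : eigenfunction lambda f.
    apply: eigenfunction_one_sum; apply: eigenfunction_disj_union => v.
      by rewrite fh (eq_bigr _ (fun w _ => fh (inl w))) e1.
    by rewrite fh (eq_bigr _ (fun w _ => fh (inr w))) e2.
  pose g : 'rV[R]_#|one_sum x1 x2| := \row_i f (enum_val i).
  have -> : row_mx u1 u2 = g *m Q.
    rewrite mul_mx_row !mulmx_colsub !mulmx1.
    by congr row_mx; apply/rowP => j; rewrite !mxE enum_rankK fh /h enum_valK.
  apply: submxMr; apply/eigenspace_laplacianP => v.
  rewrite !mxE enum_rankK -ef; congr (_ - _ * _).
  by apply: eq_bigr => w _; rewrite mxE enum_rankK.
apply: (@leq_trans (\rank (V :&: kermx c)%MS + 1)); last first.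
  rewrite leq_add2r; apply: leq_trans (mxrankS restrict) _.
  exact: mxrankM_maxl.
have <- : \rank V = (\rank E1 + \rank E2)%N by exact: rank_diag_block_mx.
exact: mxrank_cap_ker_col.
Qed.
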